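(* Consider the decomposable quadratic optimization problem $$\min_{\boldsymbol{x}}\ \sum_{i\in\mathcal{V}}\Big(\tfrac12\boldsymbol{x}_i^T\boldsymbol{\Sigma}_i\boldsymbol{x}_i-\boldsymbol{a}_i^T\boldsymbol{x}_i\Big)\quad\text{s.t. } \boldsymbol{A}_{i|j}\boldsymbol{x}_i+\boldsymbol{A}_{j|i}\boldsymbol{x}_j=\boldsymbol{c}_{ij}\ \ \forall (i,j)\in\mathcal{E}$$ over a tree-structured graph $G=(\mathcal{V},\mathcal{E})$ with optimal solution $\boldsymbol{x}^\star$, and fix a root node $r\in\mathcal{V}$ with associated directed graph $\vec{G}=(\mathcal{V},\vec{\mathcal{E}})$. Let the matrices $\{\boldsymbol{P}_{ij}\mid (i,j)\in\mathcal{E}\}$ be constructed recursively along the directed edges towards $r$ by $$\boldsymbol{P}_{ij}=\boldsymbol{A}_{i|j}\Big(\boldsymbol{\Sigma}_i+\sum_{u\in\mathcal{N}_i\setminus\{j\}}\boldsymbol{A}_{i|u}^T\boldsymbol{P}_{ui}^{-1}\boldsymbol{A}_{i|u}\Big)^{-1}\boldsymbol{A}_{i|j}^T,\qquad [i,j]\in\vec{\mathcal{E}},$$ (the sum being empty when $\mathcal{N}_i=\{j\}$), and assume that every constructed $\boldsymbol{P}_{ij}$ is symmetric positive definite. Let $\hat{\boldsymbol{x}}_i^{k}$ and $\hat{\boldsymbol{m}}_{i\rightarrow j}^{k}$, $k\ge 0$, be the iterates generated by synchronous PDMM with these matrices, from any initialization. Then it takes $\mathrm{dist}(\vec{G},r)+1$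 iterations for the estimate $\hat{\boldsymbol{x}}_r$ to reach its optimal solution, i.e. $\hat{\boldsymbol{x}}_r^{k}=\boldsymbol{x}_r^\star$ for $k\ge\mathrm{dist}(\vec{G},r)+1$; and the estimates of all other nodes take at most $2\,\mathrm{dist}(\vec{G},r)+1$ iterations to arrive at their individual optimal solutions, i.e. for every $u\in\mathcal{V}$, $u\ne r$, $\hat{\boldsymbol{x}}_u^{k}=\boldsymbol{x}_u^\star$ for $k\ge 2\,\mathrm{dist}(\vec{G},r)+1$.
   Context: Setting. $G=(\mathcal{V},\mathcal{E})$ is an undirected tree with finite node set $\mathcal{V}=\{1,\dots,m\}$; $\mathcal{N}_i=\{j\mid (i,j)\in\mathcal{E}\}$ is the set of neighbours of $i$. Node $i$ carries $\boldsymbol{x}_i\in\mathbb{R}^{n_i}$, and $\boldsymbol{x}=[\boldsymbol{x}_1^T,\dots,\boldsymbol{x}_m^T]^T$. Each $\boldsymbol{\Sigma}_i\in\mathbb{R}^{n_i\times n_i}$ is symmetric positive semi-definite, $\boldsymbol{a}_i\in\mathbb{R}^{n_i}$, and for each edge $(i,j)\in\mathcal{E}$, $\boldsymbol{A}_{i|j}\in\mathbb{R}^{n_{ij}\times n_i}$, $\boldsymbol{A}_{j|i}\in\mathbb{R}^{n_{ij}\times n_j}$, $\boldsymbol{c}_{ij}=\boldsymbol{c}_{ji}\in\mathbb{R}^{n_{ij}}$. Write $f_i(\boldsymbol{x}_i)=\frac12\boldsymbol{x}_i^T\boldsymbol{\Sigma}_i\boldsymbol{x}_i-\boldsymbol{a}_i^T\boldsymbol{x}_i$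 and $\|\boldsymbol{y}\|_{\boldsymbol{M}}^2=\boldsymbol{y}^T\boldsymbol{M}\boldsymbol{y}$. Standing assumption: the Lagrangian $L(\boldsymbol{x},\boldsymbol{\delta})=\sum_{i\in\mathcal{V}}f_i(\boldsymbol{x}_i)+\sum_{(i,j)\in\mathcal{E}}\boldsymbol{\delta}_{ij}^T(\boldsymbol{c}_{ij}-\boldsymbol{A}_{i|j}\boldsymbol{x}_i-\boldsymbol{A}_{j|i}\boldsymbol{x}_j)$ has a saddle point $(\boldsymbol{x}^\star,\boldsymbol{\delta}^\star)$; $\boldsymbol{x}^\star$ is then an optimal solution. Directed graph. For a root $r$, $\mathrm{dist}(i,r)$ is the number of edges on the path from $i$ to $r$; $\vec{\mathcal{E}}=\{[i,j]\mid (i,j)\in\mathcal{E},\ \mathrm{dist}(j,r)<\mathrm{dist}(i,r)\}$; $\mathrm{dist}(\vec{G},r)=\max_{i\in\mathcal{V}}\mathrm{dist}(i,r)$. The matrices carry no direction: $\boldsymbol{P}_{ij}=\boldsymbol{P}_{ji}$. The inverses in the recursion defining $\boldsymbol{P}_{ij}$ are assumed to exist (in particular $\boldsymbol{\Sigma}_u$ is nonsingular for non-root leaves $u$). Synchronous PDMM (message-passing form). Start from arbitrary $\hat{\boldsymbol{x}}^0$ and arbitrary messages $\hat{\boldsymbol{m}}_{i\rightarrow j}^0\in\mathbb{R}^{n_{ij}}$, $i\in\mathcal{V}$, $j\in\mathcal{N}_i$. At iteration $k=0,1,2,\dots$, simultaneously for all $i\in\mathcal{V}$ and $j\in\mathcal{N}_i$,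 $$\hat{\boldsymbol{x}}_i^{k+1}=\arg\min_{\boldsymbol{x}_i}\Big[f_i(\boldsymbol{x}_i)+\sum_{j\in\mathcal{N}_i}\tfrac12\|\boldsymbol{A}_{i|j}\boldsymbol{x}_i-\hat{\boldsymbol{m}}_{j\rightarrow i}^k\|_{\boldsymbol{P}_{ij}^{-1}}^2\Big],\qquad \hat{\boldsymbol{m}}_{i\rightarrow j}^{k+1}=\hat{\boldsymbol{m}}_{j\rightarrow i}^k+\boldsymbol{c}_{ij}-2\boldsymbol{A}_{i|j}\hat{\boldsymbol{x}}_i^{k+1}.$$ The minimizer in each such update is taken to be uniquely defined, i.e. $\boldsymbol{\Sigma}_i+\sum_{u\in\mathcal{N}_i}\boldsymbol{A}_{i|u}^T\boldsymbol{P}_{iu}^{-1}\boldsymbol{A}_{i|u}$ is nonsingular for all $i\in\mathcal{V}$. *)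

(* Defs.v *)
From HB Require Import structures.
From mathcomp Require Import all_boot all_order all_algebra.
Set Implicit Arguments.
Unset Strict Implicit.
Unset Printing Implicit Defensive.
Import Order.TTheory GRing.Theory Num.Theory.
Local Open Scope ring_scope.

Section Graph.
Variables (V : finType) (e : rel V).

(* [ucycle e [:: x; y]] holds for every edge, so only cycles on at least three
   nodes are excluded. *)
Definition is_tree : Prop :=
  [/\ symmetric e, irreflexive e, (forall i j, connect e i j)
    & (forall p : seq V, ucycle e p -> (size p <= 2)%N)].

Definition simple_path (i j : V) (p : seq V) : bool :=
  [&& path e i p, last i p == j & uniq (i :: p)].

(* The edge count of the simple path from [i] to [j], which is unique in a tree
   and never longer than [#|V|]; the value is 0 if there is no path. *)
Definition dist (i j : V) : nat :=
  if [pick p : #|V|.-bseq V | simple_path i j p] is Some p then size p else 0%N.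

Definition dist_max (r : V) : nat := (\max_(i : V) dist i r)%N.

Definition directed (r : V) : rel V :=
  [rel i j | e i j && (dist j r < dist i r)%N].

End Graph.

Definition wnorm2 (R : realFieldType) (n : nat) (M : 'M[R]_n) (y : 'cV[R]_n) : R :=
  (y^T *m M *m y) 0 0.

Definition sym_psd (R : realFieldType) (n : nat) (M : 'M[R]_n) : Prop :=
  M^T = M /\ forall y : 'cV[R]_n, 0 <= wnorm2 M y.

Definition sym_pd (R : realFieldType) (n : nat) (M : 'M[R]_n) : Prop :=
  M^T = M /\ forall y : 'cV[R]_n, y != 0 -> 0 < wnorm2 M y.

Definition is_argmin (R : realFieldType) (T : Type) (F : T -> R) (x : T) : Prop :=
  forall y : T, F x <= F y.

(* Data attached to an edge are indexed by the unordered pair [[set i; j]], so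
   that n_ij = n_ji, c_ij = c_ji and P_ij = P_ji hold without casts.  A matrix or
   vector that depends on a side of the edge takes that endpoint as a further
   argument: [A [set i; j] i] is A_{i|j} and [A [set i; j] j] is A_{j|i}.
   Values at pairs that are not edges, or at non-endpoints, are never used. *)
Record problem (R : realFieldType) (m : nat) := Problem {
  adj : rel 'I_m;
  ndim : 'I_m -> nat;
  edim : {set 'I_m} -> nat;
  Sigma : forall i : 'I_m, 'M[R]_(ndim i);
  a : forall i : 'I_m, 'cV[R]_(ndim i);
  A : forall (s : {set 'I_m}) (i : 'I_m), 'M[R]_(edim s, ndim i);
  c : forall s : {set 'I_m}, 'cV[R]_(edim s)
}.

Section Problem.
Variables (R : realFieldType) (m : nat) (Q : problem R m).

Definition primal : Type := forall i : 'I_m, 'cV[R]_(ndim Q i).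
Definition dual : Type := forall s : {set 'I_m}, 'cV[R]_(edim Q s).
Definition edge_matrices : Type := forall s : {set 'I_m}, 'M[R]_(edim Q s).
(* [mu [set i; j] i] is the message from [i] to [j]: the node argument is the
   sender. *)
Definition messages : Type :=
  forall (s : {set 'I_m}) (i : 'I_m), 'cV[R]_(edim Q s).

Definition f (i : 'I_m) (x : 'cV[R]_(ndim Q i)) : R :=
  2^-1 * wnorm2 (Sigma Q i) x - ((a Q i)^T *m x) 0 0.

Definition objective (x : primal) : R := \sum_(i < m) f (x i).

Definition feasible (x : primal) : Prop :=
  forall i j : 'I_m, adj Q i j ->
    A Q [set i; j] i *m x i + A Q [set i; j] j *m x j = c Q [set i; j].

Definition optimal (x : primal) : Prop :=
  feasible x /\ forall y : primal, feasible y -> objective x <= objective y.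

(* The condition [i < j] makes each undirected edge count once. *)
Definition lagrangian (x : primal) (delta : dual) : R :=
  objective x +
  \sum_(i < m) \sum_(j < m | adj Q i j && (i < j)%N)
    ((delta [set i; j])^T *m
       (c Q [set i; j] - A Q [set i; j] i *m x i - A Q [set i; j] j *m x j)) 0 0.

Definition saddle_point (x : primal) (delta : dual) : Prop :=
  (forall delta' : dual, lagrangian x delta' <= lagrangian x delta) /\
  (forall x' : primal, lagrangian x delta <= lagrangian x' delta).

Variable P : edge_matrices.

Definition partial_hessian (i j : 'I_m) : 'M[R]_(ndim Q i) :=
  Sigma Q i +
  \sum_(u < m | adj Q i u && (u != j))
    (A Q [set i; u] i)^T *m invmx (P [set i; u]) *m A Q [set i; u] i.

Definition full_hessian (i : 'I_m) : 'M[R]_(ndim Q i) :=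
  Sigma Q i +
  \sum_(u < m | adj Q i u)
    (A Q [set i; u] i)^T *m invmx (P [set i; u]) *m A Q [set i; u] i.

(* [invmx] is the identity on singular matrices, hence the invertibility
   clause; the [P]s being inverted are covered by [sym_pd]. *)
Definition recursive_P (r : 'I_m) : Prop :=
  forall i j : 'I_m, directed (adj Q) r i j ->
    partial_hessian i j \in unitmx /\
    P [set i; j] =
      A Q [set i; j] i *m invmx (partial_hessian i j) *m (A Q [set i; j] i)^T.

Definition local_cost (mu : messages) (i : 'I_m) (x : 'cV[R]_(ndim Q i)) : R :=
  f x +
  \sum_(j < m | adj Q i j)
    2^-1 * wnorm2 (invmx (P [set i; j])) (A Q [set i; j] i *m x - mu [set i; j] j).

Definition pdmm_iterates (xhat : nat -> primal) (mhat : nat -> messages) : Prop :=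
  forall (k : nat) (i : 'I_m),
    is_argmin (@local_cost (mhat k) i) (xhat k.+1 i) /\
    (forall j : 'I_m, adj Q i j ->
       mhat k.+1 [set i; j] i =
         mhat k [set i; j] j + c Q [set i; j]
         - 2 *: (A Q [set i; j] i *m xhat k.+1 i)).

End Problem.

(* Main.v *)
Require Import Defs.
From HB Require Import structures.
From mathcomp Require Import all_boot all_order all_algebra.
Import Order.TTheory GRing.Theory Num.Theory.
From mathcomp Require Import ring lra zify.
Set Implicit Arguments.
Unset Strict Implicit.
Unset Printing Implicit Defensive.
Local Open Scope ring_scope.

(** Let [delta] be a multiplier for which [xstar] is stationary in the
    Lagrangian.  The pair consisting of [xstar] and the messages
    m*_{i->j} = c_ij - A_{i|j} x*_i + P_ij delta_ij is a fixed point of PDMM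
    ([xstar_fixed], [fixed_message_sender]).  Because the problem is quadratic,
    the errors z = xhat - xstar and d = mhat - m* follow the homogeneous linear
    recursion ([estimate_error], [message_error])
      H_i z_i^{k+1} = sum_j A_{i|j}^T P_ij^{-1} d_{j->i}^k,
      d_{i->j}^{k+1} = d_{j->i}^k - 2 A_{i|j} z_i^{k+1},
    where H_i is [full_hessian P i].

    The choice of P makes this recursion nilpotent.  Let j be the parent of i
    and suppose that the messages received by i from its children are exact.
    Then H_i = S + A^T P^{-1} A with S the partial Hessian and A = A_{i|j}, and
    since P = A S^{-1} A^T, the estimate satisfies 2 A z_i = d_{j->i}
    ([schur_cancel]): the message sent by i to its parent is exact one
    iteration later, whatever the parent has sent to i.  Exactness thus travels
    from the deepest leaves to the root, one level per iteration
    ([upward_message_exact]).  When all messages received by a node are exact,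
    so is its next estimate, and with it the messages to its children; this
    sends exactness back from the root to the leaves, one level per iteration
    ([estimate_exact]).  With D the depth of the tree, the root is exact after
    D + 1 iterations and a node at depth l after D + 1 + l of them.

    The multiplier exists for the given optimum [xstar], not only for the primal
    part x of the saddle point: both are feasible, hence
    L(xstar, delta) = objective xstar <= objective x = L(x, delta), and since x
    minimizes L(., delta), so does [xstar] ([optimal_stationary]). *)

(** * Distances in a tree *)

Section TreeDistance.
Variables (V : finType) (e : rel V).
Hypothesis tree : is_tree e.

(** A neighbour of the first node further along a path would close a cycle on
    at least three nodes. *)
Lemma tree_neighbour_on_path (i u : V) (p : seq V) :
  e i u -> path e i p -> uniq (i :: p) -> u \in i :: p -> ohead p = Some u.
Proof.
have [esym eirr _ acyclic] := tree.
move=> eiu pth un; rewrite inE => /orP[/eqP uE|up].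
  by move: eiu; rewrite uE eirr.
case/splitPr: up pth un => p1 p2; rewrite cat_path -cat_cons cat_uniq /=.
case/and3P=> pth1 e1 _ /and3P[un1 /norP[uNp1 _] _].
have /acyclic : ucycle e (i :: rcons p1 u).
  rewrite /ucycle (cycle_path i) /= last_rcons esym eiu rcons_path pth1 e1 /=.
  move: un1 uNp1 => /= /andP[iNp1 unp1] /norP[ui uNp1].
  by rewrite mem_rcons inE negb_or rcons_uniq eq_sym ui iNp1 uNp1 unp1.
by rewrite /= size_rcons; case: p1 {pth1 e1 un1 uNp1}.
Qed.

(** Uniqueness of simple paths comes from this asymmetric form, in which the
    induction on [q] moves the start along [q] while the nodes left behind are
    prepended to [p]. *)
Lemma branching_paths_diverge (q : seq V) (x : V) (p : seq V) :
  path e x q -> uniq (x :: q) -> path e x p -> uniq (x :: p) ->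
  ohead q != ohead p -> last x q \notin p.
Proof.
have [esym _ _ _] := tree.
elim: q x p => [|v q IH] x p /=; first by move=> _ _ _ /andP[].
move=> /andP[exv pthq] /and3P[xNvq vNq unq] pthp unp hd.
have vNxp : v \notin x :: p.
  apply: contra hd => vp.
  by rewrite (tree_neighbour_on_path exv pthp unp vp).
suff: last v q \notin x :: p by rewrite inE negb_or => /andP[].
apply: IH => //=.
- by rewrite vNq.
- by rewrite esym exv.
- by rewrite vNxp.
case: q xNvq {pthq vNq unq} => [|w q] //=; rewrite !inE !negb_or => /and3P[_ xw _].
by apply: contra xw => /eqP[->].
Qed.

Lemma simple_path_unique (i r : V) (p q : seq V) :
  simple_path e i r p -> simple_path e i r q -> p = q.
Proof.
elim: p i q => [|u p IH] i [|v q] //.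
- by case/and3P=> _ /eqP <- _ /and3P[_ /eqP /= lq /andP[]]; rewrite -{1}lq mem_last.
- by move=> /and3P[_ /eqP /= lp /andP[+ _]] /and3P[_ /eqP /= ir _]; rewrite ir -lp mem_last.
case/and3P=> pthp /eqP lp unp /and3P[pthq /eqP lq unq].
have [uv|uv] := eqVneq v u.
  rewrite {}uv in pthq lq unq *; congr (_ :: _); apply: (IH u).
    by move: pthp unp => /= /andP[_ pp] /andP[_ up]; rewrite /simple_path pp /= -lp eqxx.
  by move: pthq unq => /= /andP[_ pq] /andP[_ uq]; rewrite /simple_path pq /= -lq eqxx.
have /= : last i (v :: q) \notin u :: p.
  by apply: branching_paths_diverge.
by move: lp lq => /= lp ->; rewrite -lp mem_last.
Qed.

Lemma simple_path_exists (i r : V) : exists p, simple_path e i r p.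
Proof.
have [_ _ conn _] := tree.
have /connectP[p pth ->] := conn i r.
by case/shortenP: pth => q pthq unq _; exists q; rewrite /simple_path pthq eqxx.
Qed.

Lemma dist_simple_path (i r : V) (p : seq V) :
  simple_path e i r p -> dist e i r = size p.
Proof.
move=> sp; rewrite /dist; case: pickP => [q sq|none].
  by rewrite (simple_path_unique sq sp).
have szp : (size p <= #|V|)%N.
  case/and3P: sp => _ _ un; have := max_card [in i :: p].
  by rewrite (card_uniqP un); apply: ltnW.
by have := none (Bseq szp); rewrite /= sp.
Qed.

Lemma dist_root (r : V) : dist e r r = 0%N.
Proof. by rewrite (@dist_simple_path r r [::]) // /simple_path /= eqxx. Qed.

(** The first step of the path towards [r] decreases the distance by one; any
    other neighbour of [i] extends that path by one edge. *)
Lemma dist_neighbour (i u r : V) (p : seq V) : e i u -> simple_path e i r p ->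
  if ohead p == Some u then dist e i r = (dist e u r).+1
  else dist e u r = (dist e i r).+1.
Proof.
have [esym _ _ _] := tree.
move=> eiu sp; case: ifP => [|hd].
  case: p sp => [|v p] // sp /= /eqP[vu]; rewrite (dist_simple_path sp) -vu.
  congr S; symmetry; apply: dist_simple_path.
  by case/and3P: sp => /= /andP[_ pp] lp /andP[_ up]; rewrite /simple_path pp lp ?eqxx.
rewrite (dist_simple_path sp); apply: (@dist_simple_path u r (i :: p)).
case/and3P: sp => pth lp un; rewrite /simple_path /= esym eiu pth lp /=.
rewrite -/(uniq (i :: p)) un andbT.
by apply/negP=> up; rewrite (tree_neighbour_on_path eiu pth un up) eqxx in hd.
Qed.

Lemma directed_total (r i j : V) : e i j -> directed e r i j || directed e r j i.
Proof.
have [esym _ _ _] := tree => eij.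
have [p sp] := simple_path_exists i r; have := dist_neighbour eij sp.
by rewrite /directed /= (esym j) eij; case: ifP => _ ->; rewrite ltnSn ?orbT.
Qed.

(** Every node other than the root has only one parent, so its other neighbours
    are children. *)
Lemma directed_unique (r i j u : V) :
  directed e r i j -> e i u -> u != j -> directed e r u i.
Proof.
have [esym _ _ _] := tree => /andP[eij ltji] eiu uj.
have [p sp] := simple_path_exists i r.
have := dist_neighbour eij sp; case: eqP => [pj _|_ dE]; last by rewrite dE in ltji; lia.
have := dist_neighbour eiu sp; rewrite pj; case: eqP => [[ju]|_ dE].
  by rewrite ju eqxx in uj.
by rewrite /directed /= esym eiu dE ltnSn.
Qed.

End TreeDistance.

(** * Quadratic forms and their minimizers *)

Section Quadratic.
Variable R : realFieldType.

Lemma linear_coef_eq0 (g q : R) :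
  (forall t, 0 <= t * g + t ^+ 2 * q) -> g = 0.
Proof.
move=> pos; apply/eqP/negPn/negP => g0.
have q1 : 0 < 1 + `|q| by rewrite ltr_pwDl.
(* The exact minimizer - g / (2 q) is of no use when q is 0, whereas with
   1 + |q| in the denominator the linear term always dominates. *)
have := pos (- (g / (1 + `|q|))); apply/negP; rewrite -ltNge.
have -> : - (g / (1 + `|q|)) * g + (- (g / (1 + `|q|))) ^+ 2 * q =
  (g / (1 + `|q|)) ^+ 2 * (q - (1 + `|q|)) by field; rewrite gt_eqF.
rewrite pmulr_rlt0; last by rewrite exprn_even_gt0 //= mulf_neq0 // invr_eq0 gt_eqF.
by have := ler_norm q; lra.
Qed.

Lemma dot_sym n (x y : 'cV[R]_n) : (x^T *m y) 0 0 = (y^T *m x) 0 0.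
Proof. by rewrite -[in LHS](trmxK y) -trmx_mul mxE. Qed.

Lemma dot_self_ge0 n (y : 'cV[R]_n) : 0 <= (y^T *m y) 0 0.
Proof. by rewrite mxE sumr_ge0 // => i _; rewrite mxE -expr2 sqr_ge0. Qed.

Lemma dot_self_eq0 n (y : 'cV[R]_n) : (y^T *m y) 0 0 = 0 -> y = 0.
Proof.
rewrite mxE => /psumr_eq0P y0; apply/matrixP=> i j; rewrite ord1 mxE.
apply/eqP; rewrite -sqrf_eq0; apply/eqP.
have := y0 _ i isT; rewrite mxE -expr2; apply => k _.
by rewrite mxE -expr2 sqr_ge0.
Qed.

Lemma dotDr n (b x y : 'cV[R]_n) :
  (b^T *m (x + y)) 0 0 = (b^T *m x) 0 0 + (b^T *m y) 0 0.
Proof. by rewrite mulmxDr mxE. Qed.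

Lemma dotZr n t (b x : 'cV[R]_n) :
  (b^T *m (t *: x)) 0 0 = t * (b^T *m x) 0 0.
Proof. by rewrite -scalemxAr mxE. Qed.

Lemma dotBr n (b x y : 'cV[R]_n) :
  (b^T *m (x - y)) 0 0 = (b^T *m x) 0 0 - (b^T *m y) 0 0.
Proof. by rewrite -scaleN1r dotDr dotZr mulN1r. Qed.

Lemma dot_sumr n (I : finType) (B : pred I) (b : 'cV[R]_n) (F : I -> 'cV[R]_n) :
  (b^T *m \sum_(i | B i) F i) 0 0 = \sum_(i | B i) (b^T *m F i) 0 0.
Proof. by rewrite mulmx_sumr summxE. Qed.

Lemma dot_adjoint n p (A : 'M[R]_(p, n)) (y : 'cV[R]_p) (x : 'cV[R]_n) :
  (y^T *m (A *m x)) 0 0 = ((A^T *m y)^T *m x) 0 0.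
Proof. by rewrite trmx_mul trmxK mulmxA. Qed.

Lemma wnorm2Z n (M : 'M[R]_n) t (x : 'cV[R]_n) :
  wnorm2 M (t *: x) = t ^+ 2 * wnorm2 M x.
Proof.
by rewrite /wnorm2 [(t *: x)^T]linearZ /= -!scalemxAl -scalemxAr !mxE mulrA.
Qed.

Lemma wnorm2_addmx n (M N : 'M[R]_n) (x : 'cV[R]_n) :
  wnorm2 (M + N) x = wnorm2 M x + wnorm2 N x.
Proof. by rewrite /wnorm2 mulmxDr mulmxDl mxE. Qed.

Lemma wnorm2_sum n (I : finType) (B : pred I) (M : I -> 'M[R]_n) (x : 'cV[R]_n) :
  wnorm2 (\sum_(i | B i) M i) x = \sum_(i | B i) wnorm2 (M i) x.
Proof. by rewrite /wnorm2 mulmx_sumr mulmx_suml summxE. Qed.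

Lemma wnorm2D n (M : 'M[R]_n) (x y : 'cV[R]_n) : M^T = M ->
  wnorm2 M (x + y) = wnorm2 M x + 2 * (y^T *m (M *m x)) 0 0 + wnorm2 M y.
Proof.
move=> Msym; rewrite /wnorm2 [(x + y)^T]linearD /= !mulmxDl !mulmxDr.
have xMy : (x^T *m M *m y) 0 0 = (y^T *m (M *m x)) 0 0.
  by rewrite -mulmxA dot_sym trmx_mul Msym mulmxA.
rewrite [LHS]mxE [X in X + _]mxE [X in _ + X]mxE xMy.
rewrite -(mulmxA y^T M x); ring.
Qed.

Lemma quadratic_argmin n (M : 'M[R]_n) (b x : 'cV[R]_n) : M^T = M ->
  is_argmin (fun y => 2^-1 * wnorm2 M y - (b^T *m y) 0 0) x -> M *m x = b.
Proof.
move=> Msym xmin; apply/eqP; rewrite -subr_eq0; apply/eqP.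
(* The direction of perturbation is the gradient itself. *)
set w := M *m x - b; apply: dot_self_eq0.
apply: (@linear_coef_eq0 _ (2^-1 * wnorm2 M w)) => t.
have := xmin (x + t *: w); rewrite -subr_ge0; congr (0 <= _).
rewrite wnorm2D // wnorm2Z dotDr dotZr !(dot_sym (t *: w)) dotZr -(dot_sym w).
have -> : (w^T *m w) 0 0 = (w^T *m (M *m x)) 0 0 - (b^T *m w) 0 0.
  by rewrite {2}/w dotBr (dot_sym w b).
by field.
Qed.

Lemma wnorm2_residual n p (W : 'M[R]_p) (A : 'M[R]_(p, n)) (x : 'cV[R]_n)
    (y : 'cV[R]_p) :
  W^T = W ->
  wnorm2 W (A *m x - y) =
    wnorm2 (A^T *m W *m A) x - 2 * ((A^T *m W *m y)^T *m x) 0 0 + wnorm2 W y.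
Proof.
move=> Wsym; rewrite -scaleN1r wnorm2D // wnorm2Z.
have -> : wnorm2 W (A *m x) = wnorm2 (A^T *m W *m A) x.
  by rewrite /wnorm2 trmx_mul !mulmxA.
rewrite (dot_sym (-1 *: y)) dotZr -(dot_sym y) (mulmxA W) dot_adjoint.
by rewrite [(W *m A)^T]trmx_mul Wsym; ring.
Qed.

Lemma sym_pd_unitmx n (M : 'M[R]_n) : sym_pd M -> M \in unitmx.
Proof.
case=> Msym Mpos; rewrite -row_free_unit; apply/inj_row_free => v vM0.
apply/eqP/negPn/negP => v0; have := Mpos v^T; rewrite trmx_eq0 => /(_ v0).
by rewrite /wnorm2 trmxK vM0 mul0mx mxE ltxx.
Qed.

(** Moving the P-term of the Hessian to the right gives
    z = S^{-1} A^T P^{-1} (d - A z); multiplying by A turns the factor in front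
    into P P^{-1}, so A z = d - A z. *)
Lemma schur_cancel n p (S : 'M[R]_n) (A : 'M[R]_(p, n)) (P : 'M[R]_p)
    (z : 'cV[R]_n) (d : 'cV[R]_p) :
  S \in unitmx -> P \in unitmx -> P = A *m invmx S *m A^T ->
  (S + A^T *m invmx P *m A) *m z = A^T *m invmx P *m d ->
  2 *: (A *m z) = d.
Proof.
move=> Su Pu PE eqz.
have Sz : S *m z = A^T *m (invmx P *m (d - A *m z)).
  by apply/eqP; rewrite !mulmxBr !mulmxA -eqz mulmxDl addrK.
have -> : d = A *m z + (d - A *m z) by rewrite addrC subrK.
rewrite scaler_nat mulr2n; congr (_ + _).
by rewrite -[in LHS](mulKmx Su z) Sz !mulmxA -PE mulmxV // mul1mx.
Qed.

End Quadratic.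

(** * Multipliers at the optimum *)

Section Separable.
Variables (R : realFieldType) (m : nat) (Q : problem R m).

Lemma separable_argmin (phi : forall i : 'I_m, 'cV[R]_(ndim Q i) -> R) (x : primal Q) :
  is_argmin (fun y : primal Q => \sum_(i < m) phi i (y i)) x ->
  forall i, is_argmin (phi i) (x i).
Proof.
move=> xmin i y.
have := xmin (dfwith x y : primal Q).
rewrite (bigD1 i) //= [X in _ <= X](bigD1 i) //= dfwith_in.
rewrite [X in _ <= _ + X](eq_bigr (fun j => phi j (x j))) ?lerD2r //.
by move=> j ji; rewrite dfwith_out // eq_sym.
Qed.

End Separable.

Section Iteration.
Variables (R : realFieldType) (m : nat) (Q : problem R m).
Hypothesis adj_sym : symmetric (adj Q).
Hypothesis adj_irr : irreflexive (adj Q).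
Hypothesis Sigma_sym : forall i, (Sigma Q i)^T = Sigma Q i.

Lemma sum_edges (F : 'I_m -> 'I_m -> R) :
  \sum_(i < m) \sum_(j < m | adj Q i j) F i j =
  \sum_(i < m) \sum_(j < m | adj Q i j && (i < j)%N) (F i j + F j i).
Proof.
under [in RHS]eq_bigr do rewrite big_split.
rewrite big_split /= [X in _ = _ + X](exchange_big_dep xpredT) //= -big_split /=.
apply: eq_bigr => i _; rewrite (bigID (fun j : 'I_m => (i < j)%N)) /=; congr (_ + _).
apply: eq_bigl => j; rewrite (adj_sym j); case aij: (adj Q i j) => //=.
rewrite -leqNgt leq_eqVlt; case: eqVneq => //= ij.
by move: aij; rewrite (val_inj ij) adj_irr.
Qed.

(** For a fixed multiplier the coupling terms can be regrouped by node, which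
    leaves one independent quadratic per node. *)
Lemma lagrangian_separable (x : primal Q) (delta : dual Q) :
  lagrangian x delta =
  \sum_(i < m) (2^-1 * wnorm2 (Sigma Q i) (x i) -
     ((a Q i + \sum_(j < m | adj Q i j) (A Q [set i; j] i)^T *m delta [set i; j])^T
        *m x i) 0 0) +
  \sum_(i < m) \sum_(j < m | adj Q i j && (i < j)%N)
     ((delta [set i; j])^T *m c Q [set i; j]) 0 0.
Proof.
rewrite /lagrangian /objective /f.
have -> : \sum_(i < m) \sum_(j < m | adj Q i j && (i < j)%N)
    ((delta [set i; j])^T *m
       (c Q [set i; j] - A Q [set i; j] i *m x i - A Q [set i; j] j *m x j)) 0 0 =
   \sum_(i < m) \sum_(j < m | adj Q i j && (i < j)%N)
     ((delta [set i; j])^T *m c Q [set i; j]) 0 0 -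
   \sum_(i < m) \sum_(j < m | adj Q i j)
     (((A Q [set i; j] i)^T *m delta [set i; j])^T *m x i) 0 0.
  rewrite sum_edges -sumrB; apply: eq_bigr => i _; rewrite -sumrB; apply: eq_bigr => j _.
  by rewrite !dotBr !dot_adjoint (setUC [set j]) opprD addrA.
rewrite addrCA addrC -sumrB; congr (_ + _); apply: eq_bigr => i _.
rewrite -addrA -opprD; congr (_ - _).
rewrite [in RHS]dot_sym dotDr dot_sumr (dot_sym (x i) (a Q i)); congr (_ + _).
by apply: eq_bigr => j _; rewrite dot_sym.
Qed.

(** Adding the constraint residuals to [delta] raises the Lagrangian by the sum
    of their squared norms. *)
Lemma saddle_feasible (x : primal Q) (delta : dual Q) :
  (forall delta', lagrangian x delta' <= lagrangian x delta) -> feasible x.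
Proof.
move=> dmax.
(* Summing over the members of [s] makes the residual a function of the
   unordered pair alone, as a multiplier has to be. *)
pose res (s : {set 'I_m}) := c Q s - \sum_(u in s) A Q s u *m x u.
have resE i j : adj Q i j ->
    res [set i; j] = c Q [set i; j] - A Q [set i; j] i *m x i - A Q [set i; j] j *m x j.
  move=> aij; have ij : i != j by apply: contraTneq aij => ->; rewrite adj_irr.
  by rewrite /res big_setU1 ?inE //= big_set1 opprD addrA.
have pos i j : 0 <= ((res [set i; j])^T *m res [set i; j]) 0 0 by exact: dot_self_ge0.
have := dmax (fun s => delta s + res s).
rewrite /lagrangian lerD2l -subr_le0 -sumrB.
rewrite (eq_bigr (fun i => \sum_(j < m | adj Q i j && (i < j)%N)
   ((res [set i; j])^T *m res [set i; j]) 0 0)); last first.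
  move=> i _; rewrite -sumrB; apply: eq_bigr => j /andP[aij _].
  by rewrite -resE // !(dot_sym _ (res _)) dotDr addrAC subrr add0r.
move=> le0.
have sum0 i j : adj Q i j -> (i < j)%N -> res [set i; j] = 0.
  move=> aij ij; apply: dot_self_eq0.
  have z : \sum_(i < m) \sum_(j < m | adj Q i j && (i < j)%N)
      ((res [set i; j])^T *m res [set i; j]) 0 0 = 0.
    by apply/eqP; rewrite eq_le le0 !sumr_ge0 // => k _; apply: sumr_ge0.
  have := psumr_eq0P _ z (i := i) isT => /(_ (fun k _ => sumr_ge0 _ (fun l _ => pos k l))) zi.
  by have := psumr_eq0P (fun l _ => pos i l) zi (i := j); rewrite aij ij => ->.
have feas_lt i j : adj Q i j -> (i < j)%N ->
    A Q [set i; j] i *m x i + A Q [set i; j] j *m x j = c Q [set i; j].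
  move=> aij ij; have := sum0 i j aij ij; rewrite resE // -addrA -opprD => /eqP.
  by rewrite subr_eq0 => /eqP.
move=> i j aij; case: (ltngtP i j) => [||ij]; first exact: feas_lt.
  by rewrite addrC setUC; apply: feas_lt; rewrite adj_sym.
by move: aij; rewrite (val_inj ij) adj_irr.
Qed.

Lemma lagrangian_feasible (x : primal Q) (delta : dual Q) :
  feasible x -> lagrangian x delta = objective x.
Proof.
move=> feas; rewrite /lagrangian !big1 ?addr0 // => i _; rewrite big1 // => j /andP[aij _].
by rewrite -addrA -opprD feas // subrr mulmx0 mxE.
Qed.

(** All optima share the multiplier of the saddle point, because the Lagrangian
    equals the objective at feasible points. *)
Lemma optimal_stationary (xstar : primal Q) :
  (exists (x : primal Q) (delta : dual Q), saddle_point x delta) -> optimal xstar ->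
  exists delta : dual Q, forall i, Sigma Q i *m xstar i =
    a Q i + \sum_(j < m | adj Q i j) (A Q [set i; j] i)^T *m delta [set i; j].
Proof.
move=> [x [delta [dmax xmin]]] [feas opt]; exists delta => i.
have xfeas := saddle_feasible dmax.
have smin : is_argmin (fun y : primal Q => lagrangian y delta) xstar.
  move=> y; apply: le_trans (xmin y).
  by rewrite !lagrangian_feasible //; apply: opt.
apply: quadratic_argmin => //.
apply: (@separable_argmin _ _ _ (fun i y => 2^-1 * wnorm2 (Sigma Q i) y -
     ((a Q i + \sum_(j < m | adj Q i j) (A Q [set i; j] i)^T *m delta [set i; j])^T
        *m y) 0 0)) => y.
by have := smin y; rewrite !lagrangian_separable lerD2r.
Qed.

(** * The fixed point of the iteration and the error recursion *)

Variable P : edge_matrices Q.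
Hypothesis P_pd : forall i j, adj Q i j -> sym_pd (P [set i; j]).

Lemma invmx_P_sym i j : adj Q i j -> (invmx (P [set i; j]))^T = invmx (P [set i; j]).
Proof. by move/P_pd=> [Psym _]; rewrite trmx_inv Psym. Qed.

Lemma local_argmin_stationary (mu : messages Q) (i : 'I_m) (x : 'cV[R]_(ndim Q i)) :
  is_argmin (@local_cost _ _ _ P mu i) x ->
  full_hessian P i *m x = a Q i +
    \sum_(j < m | adj Q i j)
      (A Q [set i; j] i)^T *m invmx (P [set i; j]) *m mu [set i; j] j.
Proof.
move=> xmin; apply: quadratic_argmin.
  rewrite /full_hessian linearD /= Sigma_sym; congr (_ + _); rewrite linear_sum /=.
  by apply: eq_bigr => j aij; rewrite !trmx_mul trmxK invmx_P_sym // mulmxA.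
move=> y; have := xmin y; rewrite /local_cost /f.
have costE z : 2^-1 * wnorm2 (Sigma Q i) z - ((a Q i)^T *m z) 0 0 +
    \sum_(j < m | adj Q i j) 2^-1 * wnorm2 (invmx (P [set i; j]))
        (A Q [set i; j] i *m z - mu [set i; j] j) =
  2^-1 * wnorm2 (full_hessian P i) z -
    ((a Q i + \sum_(j < m | adj Q i j)
      (A Q [set i; j] i)^T *m invmx (P [set i; j]) *m mu [set i; j] j)^T *m z) 0 0 +
  \sum_(j < m | adj Q i j) 2^-1 * wnorm2 (invmx (P [set i; j])) (mu [set i; j] j).
  rewrite (eq_bigr _ (fun j aij => congr1 _ (wnorm2_residual _ _ _ (invmx_P_sym aij)))).
  rewrite -!mulr_sumr !big_split /= sumrN -mulr_sumr.
  rewrite wnorm2_addmx wnorm2_sum dot_sym [in RHS]dot_sym dotDr dot_sumr.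
  rewrite (eq_bigr _ (fun j _ => dot_sym _ _)).
  by field.
by rewrite !costE lerD2r.
Qed.

Variables (xstar : primal Q) (delta : dual Q).
Hypothesis xstar_feasible : feasible xstar.
Hypothesis xstar_stationary : forall i, Sigma Q i *m xstar i =
  a Q i + \sum_(j < m | adj Q i j) (A Q [set i; j] i)^T *m delta [set i; j].

(** The equation P_ij^{-1} (A_{i|j} x*_i - m*_{j->i}) = - delta_ij, which turns
    the stationarity of the local cost at [xstar] into that of the Lagrangian,
    amounts to m*_{j->i} = A_{i|j} x*_i + P_ij delta_ij.  Feasibility replaces
    A_{i|j} x*_i by c_ij - A_{j|i} x*_j, where only the sender occurs. *)
Definition fixed_message : messages Q :=
  fun s i => c Q s - A Q s i *m xstar i + P s *m delta s.

Lemma fixed_message_sender i j : adj Q i j ->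
  fixed_message [set i; j] j =
    A Q [set i; j] i *m xstar i + P [set i; j] *m delta [set i; j].
Proof. by move=> aij; rewrite /fixed_message -xstar_feasible // addrK. Qed.

Lemma xstar_fixed i : full_hessian P i *m xstar i = a Q i +
    \sum_(j < m | adj Q i j)
      (A Q [set i; j] i)^T *m invmx (P [set i; j]) *m fixed_message [set i; j] j.
Proof.
rewrite /full_hessian mulmxDl xstar_stationary -addrA; congr (_ + _).
rewrite mulmx_suml -big_split /=; apply: eq_bigr => j aij.
rewrite fixed_message_sender // mulmxDr addrC !mulmxA mulmxKV //.
exact: sym_pd_unitmx (P_pd aij).
Qed.

Variables (xhat : nat -> primal Q) (mhat : nat -> messages Q).
Hypothesis iter : pdmm_iterates P xhat mhat.

Let z k i := xhat k i - xstar i.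
Let d k s i := mhat k s i - fixed_message s i.

Lemma estimate_error k i : full_hessian P i *m z k.+1 i =
  \sum_(j < m | adj Q i j)
     (A Q [set i; j] i)^T *m invmx (P [set i; j]) *m d k [set i; j] j.
Proof.
rewrite mulmxBr xstar_fixed (local_argmin_stationary (iter k i).1).
rewrite opprD addrACA subrr add0r -sumrB.
by apply: eq_bigr => j _; rewrite mulmxBr.
Qed.

Lemma message_error k i j : adj Q i j ->
  d k.+1 [set i; j] i = d k [set i; j] j - 2 *: (A Q [set i; j] i *m z k.+1 i).
Proof.
move=> aij; rewrite /d /z (iter k i).2 // fixed_message_sender // mulmxBr.
rewrite /fixed_message.
move: (mhat _ _ _) (_ *m xhat _ _) (_ *m xstar _) (_ *m delta _) => u v w y.
by apply/matrixP=> p q; rewrite !mxE; ring.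
Qed.

(** * Exactness travels to the root and back *)

Variable r : 'I_m.
Hypothesis tree : is_tree (adj Q).
Hypothesis P_rec : recursive_P P r.
Hypothesis unique_update : forall i, full_hessian P i \in unitmx.

Let D := dist_max (adj Q) r.
Let depth i := dist (adj Q) i r.

(** The deepest level becomes exact at the first iteration and each level above
    it one iteration after its children. *)
Lemma upward_message_exact k i j :
  directed (adj Q) r i j -> (D < k + depth i)%N -> d k [set i; j] i = 0.
Proof.
elim: k i j => [|k IH] i j ij.
  by rewrite ltnNge /D /dist_max (leq_bigmax i).
move=> Dk; have /andP[aij _] := ij.
rewrite message_error //; have [Su PE] := P_rec ij.
have Pu := sym_pd_unitmx (P_pd aij).
rewrite (schur_cancel (d := d k [set i; j] j) Su Pu PE) ?subrr //.
have := estimate_error k i.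
rewrite /full_hessian (bigD1 j) //= addrCA addrC -/(partial_hessian P i j) => ->.
(* The remaining terms come from the children of [i], already exact. *)
rewrite (bigD1 j) //= big1 ?addr0 // => u /andP[aiu uj].
have ui := directed_unique tree ij aiu uj.
rewrite setUC IH ?mulmx0 //; have /andP[_] := ui; rewrite -/(depth _) -/(depth u); lia.
Qed.

(** An estimate is exact once all received messages are.  Those from children
    are so by [upward_message_exact]; the one from the parent is so because it
    combines an exact upward message with an exact estimate of the parent. *)
Lemma estimate_exact k i : (D + depth i < k)%N -> xhat k i = xstar i.
Proof.
move=> Dk; apply/eqP; rewrite -subr_eq0; apply/eqP; move: k i Dk.
suff zero k i : (D + depth i < k)%N -> z k i = 0 by exact: zero.
elim: k i => [|k IH] i // Dk.
rewrite -[LHS](mulKmx (unique_update i)) estimate_error big1 ?mulmx0 // => j aij.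
suff -> : d k [set i; j] j = 0 by rewrite mulmx0.
case/orP: (directed_total tree r aij) => dir; have /andP[_] := dir;
  rewrite -/(depth i) -/(depth j) => closer.
  case: k IH Dk => [|k] IH Dk; first by lia.
  have zj : z k.+1 j = 0 by apply: IH; lia.
  have di : d k [set i; j] i = 0 by apply: upward_message_exact => //; lia.
  have aji : adj Q j i by rewrite adj_sym.
  by rewrite setUC (message_error k aji) setUC di zj mulmx0 scaler0 subr0.
rewrite setUC; apply: upward_message_exact => //; lia.
Qed.

End Iteration.

Theorem theorem2 (R : realFieldType) (m : nat) (Q : problem R m) (r : 'I_m)
    (P : edge_matrices Q) (xstar : primal Q)
    (xhat : nat -> primal Q) (mhat : nat -> messages Q)
    (tree : is_tree (adj Q))
    (Sigma_psd : forall i : 'I_m, sym_psd (Sigma Q i))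
    (saddle : exists (x : primal Q) (delta : dual Q), saddle_point x delta)
    (xstar_opt : optimal xstar)
    (P_rec : recursive_P P r)
    (P_pd : forall i j : 'I_m, directed (adj Q) r i j -> sym_pd (P [set i; j]))
    (unique_update : forall i : 'I_m, full_hessian P i \in unitmx)
    (iter : pdmm_iterates P xhat mhat) :
  (forall k : nat, (dist_max (adj Q) r + 1 <= k)%N -> xhat k r = xstar r) /\
  (forall u : 'I_m, u != r ->
     forall k : nat, (2 * dist_max (adj Q) r + 1 <= k)%N -> xhat k u = xstar u).
Proof.
have [adj_sym adj_irr _ _] := tree.
have Sigma_sym i : (Sigma Q i)^T = Sigma Q i := (Sigma_psd i).1.
have P_pd_edge i j : adj Q i j -> sym_pd (P [set i; j]).
  by move/(directed_total tree r)/orP=> [|ji]; [|rewrite setUC]; apply: P_pd.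
have [delta stat] := optimal_stationary adj_sym adj_irr Sigma_sym saddle xstar_opt.
have exact_after k i :
    (dist_max (adj Q) r + dist (adj Q) i r < k)%N -> xhat k i = xstar i.
  exact: (estimate_exact adj_sym Sigma_sym P_pd_edge xstar_opt.1 stat iter).
split=> [k|u _ k] Dk; apply: exact_after.
  by rewrite (dist_root tree); lia.
have : (dist (adj Q) u r <= dist_max (adj Q) r)%N by rewrite /dist_max (leq_bigmax u).
by lia.
Qed.
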